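(* Let $A$ be a finite-dimensional unimodular ribbon Hopf algebra over a field $k$, with an integral $\Lambda\in A$ and a right integral $\lambda\in A^*$ such that $\lambda(\Lambda)=1$. Then: (a) $\star: Z(A)\otimes Z(A)\to Z(A)$ defines an associative product on $Z(A)$ with identity $\Lambda$, and for any $a,b\in Z(A)$, $S(a\star b)=S(b)\star S(a)$; (b) $\star$ defines an associative and commutative product on $\hat Z(A)$.
   Context: $A=(A,m,\Delta,S,\epsilon,e)$ is a finite-dimensional Hopf algebra over a field $k$ (multiplication $m$, comultiplication $\Delta$, antipode $S$, counit $\epsilon$, unit $e$); Sweedler notation $\Delta(a)=\sum_a a_{(1)}\otimes a_{(2)}$. Quasitriangular: $A$ is endowed with an invertible element $R=\sum_i\alpha_i\otimes\beta_i\in A\otimes A$ such that $T\circ\Delta(a)=R\Delta(a)R^{-1}$ for all $a\in A$ (with $T$ the flip), $(\Delta\otimes1)R=R^{13}R^{23}$ and $(1\otimes\Delta)R=R^{13}R^{12}$. Ribbon: $A$ is quasitriangular and endowed with a grouplike element $g\in A$ ($g$ is invertible and $\Delta(g)=g\otimes g$) such that $S^2(a)=gag^{-1}$ for all $a\in A$. Unimodular: the spaces of left and right integrals of $A$ coincide. $\Lambda\in A$ is an integral ($a\Lambda=\Lambda a=\epsilon(a)\Lambda$ for all $a\in A$) and $\lambda\in A^*$ is a right integral for $A^*$ ($\sum_a\lambda(a_{(1)})a_{(2)}=\lambda(a)1$ for all $a\in A$). The linear map $\star:A\otimes A\to A$ is $a\star b=\sum_b\lambda(S(a)b_{(1)})b_{(2)}$.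 $Z(A)$ is the center of $A$; $K(A)=\{a\in Z(A)\mid \lambda(ab)=0\text{ for any }b\in Z(A)\}$, an ideal of $Z(A)$; $\hat Z(A)=Z(A)/K(A)$ is the quotient algebra. *)

(* Defs.v *)
From HB Require Import structures.
From mathcomp Require Import all_boot all_order all_algebra all_field.
From mathcomp Require Import generic_quotient ring_quotient.

Set Implicit Arguments.
Unset Strict Implicit.
Unset Printing Implicit Defensive.

Import GRing.Theory VectorInternalTheory.
Local Open Scope ring_scope.
Local Open Scope quotient_scope.

(* The tensor product of two finite-dimensional spaces, in coordinates:       *)
(* u \ox v is the outer product of the coordinate vectors of u and v.  It is  *)
(* characterised by tensor_liftE and tensor_lift_unique.                      *)
Definition tensor (k : fieldType) (U V : vectType k) : Type :=
  'M[k]_(dim U, dim V).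

Notation "U ⊗ V" := (tensor U V) (at level 40, left associativity) : type_scope.

HB.instance Definition _ (k : fieldType) (U V : vectType k) :=
  Vector.copy (U ⊗ V) 'M[k]_(dim U, dim V).

Section Tensor.
Variable k : fieldType.

Section Lift.
Variables U V W : vectType k.

Definition pure_tensor (u : U) (v : V) : U ⊗ V := (v2r u)^T *m v2r v.

Let ev (T : vectType k) (i : 'I_(dim T)) : T := r2v (delta_mx 0 i).

Definition tensor_lift_fun (f : U -> V -> W) (t : U ⊗ V) : W :=
  \sum_i \sum_j (t : 'M_(_, _)) i j *: f (ev i) (ev j).

Fact tensor_lift_is_linear f : linear (tensor_lift_fun f).
Proof.
move=> a s t; rewrite /tensor_lift_fun scaler_sumr -big_split /=.
apply: eq_bigr => i _; rewrite scaler_sumr -big_split /=.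
by apply: eq_bigr => j _; rewrite !mxE scalerDl scalerA.
Qed.
HB.instance Definition _ f := GRing.isSemilinear.Build k (U ⊗ V) W _
  (tensor_lift_fun f) (GRing.semilinear_linear (tensor_lift_is_linear f)).

(* The linear map u \ox v |-> f u v, for f bilinear.                          *)
Definition tensor_lift (f : U -> V -> W) : 'Hom(U ⊗ V, W) :=
  linfun (tensor_lift_fun f).

Lemma pure_tensor_linearl v : linear (pure_tensor^~ v).
Proof.
by move=> a x y; rewrite /pure_tensor linearP /= linearP /= mulmxDl -scalemxAl.
Qed.

Lemma pure_tensor_linearr u : linear (pure_tensor u).
Proof. by move=> a x y; rewrite /pure_tensor linearP /= mulmxDr -scalemxAr. Qed.

Let ev_sum (T : vectType k) (u : T) : u = \sum_i v2r u 0 i *: ev i.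
Proof.
apply: v2r_inj; rewrite linear_sum [LHS]row_sum_delta; apply: eq_bigr => i _.
by rewrite linearZ /= r2vK.
Qed.

Lemma tensor_liftE (f : U -> V -> W) u v :
    (forall y, linear (f^~ y)) -> (forall x, linear (f x)) ->
  tensor_lift f (pure_tensor u v) = f u v.
Proof.
move=> fl fr; rewrite lfunE /= /tensor_lift_fun.
have f0l y : f 0 y = 0.
  by have:= fl y (-1) 0 0; rewrite !scaleN1r oppr0 addr0 addNr.
have f0r x : f x 0 = 0.
  by have:= fr x (-1) 0 0; rewrite !scaleN1r oppr0 addr0 addNr.
have suml (I : finType) (a : I -> k) (e : I -> U) y :
    f (\sum_i a i *: e i) y = \sum_i a i *: f (e i) y.
  by elim/big_rec2: _ => [|i z1 z2 _ <-]; rewrite ?f0l ?fl.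
have sumr (I : finType) (a : I -> k) (e : I -> V) x :
    f x (\sum_i a i *: e i) = \sum_i a i *: f x (e i).
  by elim/big_rec2: _ => [|i z1 z2 _ <-]; rewrite ?f0r ?fr.
rewrite [in RHS](ev_sum u) [in RHS](ev_sum v) suml; apply: eq_bigr => i _.
rewrite sumr scaler_sumr; apply: eq_bigr => j _.
by rewrite scalerA mxE big_ord1 mxE.
Qed.

Lemma tensor_sum (t : U ⊗ V) :
  t = \sum_i \sum_j (t : 'M_(_, _)) i j *: pure_tensor (ev i) (ev j).
Proof.
apply/matrixP => i j; rewrite [t in LHS]matrix_sum_delta.
congr (fun_of_matrix _ i j); apply: eq_bigr => a _; apply: eq_bigr => b _.
congr (_ *: _); apply/matrixP => x y.
by rewrite /pure_tensor !r2vK !mxE big_ord1 !mxE !eqxx /= -natrM mulnb.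
Qed.

Lemma tensor_lift_unique (f g : 'Hom(U ⊗ V, W)) :
  (forall u v, f (pure_tensor u v) = g (pure_tensor u v)) -> f = g.
Proof.
move=> fg; apply/lfunP => t; rewrite (tensor_sum t) !linear_sum.
apply: eq_bigr => i _; rewrite !linear_sum; apply: eq_bigr => j _.
by rewrite !linearZ /= fg.
Qed.

End Lift.
End Tensor.

Notation "u \ox v" := (pure_tensor u v)
  (at level 40, left associativity) : ring_scope.

Section TensorMaps.
Variable k : fieldType.

Definition tensor_map (U V U' V' : vectType k)
    (f : 'Hom(U, U')) (g : 'Hom(V, V')) : 'Hom(U ⊗ V, U' ⊗ V') :=
  tensor_lift (fun u v => f u \ox g v).

Definition tensor_flip (U V : vectType k) : 'Hom(U ⊗ V, V ⊗ U) :=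
  tensor_lift (fun u v => v \ox u).

Definition tensor_assoc (U V W : vectType k) :
    'Hom((U ⊗ V) ⊗ W, U ⊗ (V ⊗ W)) :=
  tensor_lift (fun t w => tensor_lift (fun u v => u \ox (v \ox w)) t).

End TensorMaps.

Section TensorAlgebra.
Variables (k : fieldType) (A B : falgType k).
Implicit Types (a c : A) (b d : B) (r s t : A ⊗ B).

Definition tensor_mul s t : A ⊗ B :=
  tensor_lift (fun a b => tensor_lift (fun c d => (a * c) \ox (b * d)) t) s.

Definition tensor_one : A ⊗ B := 1 \ox 1.

Fact tensor_mull t : linear (tensor_mul^~ t).
Proof. by move=> x r s; rewrite /tensor_mul linearP. Qed.

Fact tensor_mulr s : linear (tensor_mul s).
Proof.
move=> x r t; rewrite /tensor_mul ![tensor_lift _ s]lfunE /= /tensor_lift_fun.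
rewrite scaler_sumr -big_split /=.
apply: eq_bigr => i _; rewrite scaler_sumr -big_split /=.
by apply: eq_bigr => j _; rewrite linearP scalerDr !scalerA mulrC.
Qed.

Fact tensor_mulE a b c d :
  tensor_mul (a \ox b) (c \ox d) = (a * c) \ox (b * d).
Proof.
have l1 (a0 : A) (b0 d0 : B) : linear (fun c0 => (a0 * c0) \ox (b0 * d0)).
  move=> x y z; rewrite mulrDr -scalerAr.
  exact: (pure_tensor_linearl (b0 * d0)).
have l2 (a0 c0 : A) (b0 : B) : linear (fun d0 => (a0 * c0) \ox (b0 * d0)).
  move=> x y z; rewrite mulrDr -scalerAr.
  exact: (pure_tensor_linearr (a0 * c0)).
rewrite /tensor_mul tensor_liftE ?tensor_liftE //.
- move=> b0 x y z; pose F (a0 : A) := tensor_lift (fun c d => (a0 * c) \ox (b0 * d)).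
  suff -> : tensor_lift (fun c d => ((x *: y + z) * c) \ox (b0 * d))
            = x *: F y + F z by rewrite add_lfunE scale_lfunE.
  apply: tensor_lift_unique => c0 d0; rewrite add_lfunE scale_lfunE !tensor_liftE //.
  by rewrite mulrDl -scalerAl; apply: (pure_tensor_linearl (b0 * d0)).
- move=> a0 x y z; pose F (b0 : B) := tensor_lift (fun c d => (a0 * c) \ox (b0 * d)).
  suff -> : tensor_lift (fun c d => (a0 * c) \ox ((x *: y + z) * d))
            = x *: F y + F z by rewrite add_lfunE scale_lfunE.
  apply: tensor_lift_unique => c0 d0; rewrite add_lfunE scale_lfunE !tensor_liftE //.
  by rewrite mulrDl -scalerAl; apply: (pure_tensor_linearr (a0 * c0)).
Qed.

Lemma tensor_ind (P : A ⊗ B -> Prop) :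
    (forall x s t, P s -> P t -> P (x *: s + t)) -> P 0 ->
  (forall a b, P (a \ox b)) -> forall t, P t.
Proof.
move=> PD P0 Pp t; rewrite (tensor_sum t).
have PS (I : finType) (a : I -> k) (F : I -> A ⊗ B) :
    (forall i, P (F i)) -> P (\sum_i a i *: F i).
  by move=> PF; elim/big_rec: _ => // i s _ Ps; apply: PD.
elim/big_rec: _ => // i s _ Ps; rewrite -[X in X + _]scale1r.
by apply: PD => //; apply: PS.
Qed.

Let mul0t t : tensor_mul 0 t = 0. Proof. by rewrite /tensor_mul linear0. Qed.
Let mult0 t : tensor_mul t 0 = 0.
Proof. by have:= tensor_mulr t (-1) 0 0; rewrite scaleN1r oppr0 addr0 scaleN1r
  addNr. Qed.

Fact tensor_mulA : associative tensor_mul.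
Proof.
move=> r s t; elim/tensor_ind: r => [x r r' IH IH'||a b].
- by rewrite !tensor_mull IH IH'.
- by rewrite !mul0t.
elim/tensor_ind: s => [x s s' IH IH'||a' b'].
- by rewrite tensor_mull !tensor_mulr tensor_mull IH IH'.
- by rewrite mul0t !mult0 mul0t.
elim/tensor_ind: t => [x t t' IH IH'||a'' b''].
- by rewrite !tensor_mulr IH IH'.
- by rewrite !mult0.
by rewrite !tensor_mulE !mulrA.
Qed.

Fact tensor_mul1l : left_id tensor_one tensor_mul.
Proof.
elim/tensor_ind => [x s t IH IH'||a b]; rewrite ?tensor_mulr ?IH ?IH' //.
by rewrite tensor_mulE !mul1r.
Qed.

Fact tensor_mul1r : right_id tensor_one tensor_mul.
Proof.
elim/tensor_ind => [x s t IH IH'||a b]; rewrite ?tensor_mull ?IH ?IH' //.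
by rewrite tensor_mulE !mulr1.
Qed.

Fact tensor_mulDl : left_distributive tensor_mul +%R.
Proof. by move=> r s t; have:= tensor_mull t 1 r s; rewrite !scale1r. Qed.

Fact tensor_mulDr : right_distributive tensor_mul +%R.
Proof. by move=> r s t; have:= tensor_mulr r 1 s t; rewrite !scale1r. Qed.

Fact tensor_one_neq0 : tensor_one != 0.
Proof.
have nz (C : falgType k) : exists i, v2r (1 : C) 0 i != 0.
  apply/existsP; rewrite -negb_forall; apply/negP => /forallP z.
  have /eqP[] := oner_neq0 C; apply: v2r_inj; apply/rowP => i.
  by rewrite linear0 mxE (eqP (z i)).
have [[i nzi] [j nzj]] := (nz A, nz B).
apply/eqP => /matrixP/(_ i j)/eqP; rewrite !mxE big_ord1 !mxE mulf_eq0.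
by rewrite (negPf nzi) (negPf nzj).
Qed.

HB.instance Definition _ := GRing.Zmodule_isNzRing.Build (A ⊗ B)
  tensor_mulA tensor_mul1l tensor_mul1r tensor_mulDl tensor_mulDr
  tensor_one_neq0.

Fact tensor_scaleAl x s t : x *: (s * t) = (x *: s) * t.
Proof.
by have:= tensor_mull t x s 0; rewrite !addr0 mul0t addr0; apply: esym.
Qed.

HB.instance Definition _ := GRing.Lmodule_isLalgebra.Build k (A ⊗ B)
  tensor_scaleAl.

Fact tensor_scaleAr x s t : x *: (s * t) = s * (x *: t).
Proof.
by have:= tensor_mulr s x t 0; rewrite !addr0 mult0 addr0; apply: esym.
Qed.

HB.instance Definition _ := GRing.Lalgebra_isAlgebra.Build k (A ⊗ B)
  tensor_scaleAr.
HB.instance Definition _ := Algebra_isFalgebra.Build k (A ⊗ B).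

End TensorAlgebra.

HB.mixin Record Falgebra_isHopf (k : fieldType) A of Falgebra k A := {
  comul : 'AHom(A, A ⊗ A);
  counit : 'AHom(A, k^o);
  antipode : 'End(A);
  comulA : forall a : A,
    tensor_assoc A A A (tensor_map comul \1 (comul a))
    = tensor_map \1 comul (comul a);
  counitl : forall a : A,
    tensor_lift (fun x y : A => (counit x : k) *: y) (comul a) = a;
  counitr : forall a : A,
    tensor_lift (fun x y : A => (counit y : k) *: x) (comul a) = a;
  antipodel : forall a : A,
    tensor_lift (fun x y : A => antipode x * y) (comul a) = (counit a : k)%:A;
  antipoder : forall a : A,
    tensor_lift (fun x y : A => x * antipode y) (comul a) = (counit a : k)%:A
}.

#[short(type="hopfAlgType")]
HB.structure Definition HopfAlgebra (k : fieldType) :=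
  { A of Falgebra_isHopf k A & Falgebra k A }.

Section Hopf.
Variables (k : fieldType) (A : hopfAlgType k).
Implicit Types (a b x y g Lam : A) (R : A ⊗ A) (lam : 'Hom(A, k^o)).

Local Notation Δ := (@comul k A).
Local Notation ε := (@counit k A).
Local Notation S := (@antipode k A).

(* For R = \sum_i α_i \ox β_i: R12 = \sum_i α_i \ox β_i \ox 1, etc.; triple  *)
(* tensor products are bracketed to the right.                                *)
Definition leg12 R : A ⊗ (A ⊗ A) := tensor_lift (fun x y => x \ox (y \ox 1)) R.
Definition leg13 R : A ⊗ (A ⊗ A) := tensor_lift (fun x y => x \ox (1 \ox y)) R.
Definition leg23 R : A ⊗ (A ⊗ A) := tensor_lift (fun x y => 1 \ox (x \ox y)) R.

Definition quasitriangular R : Prop :=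
  [/\ R \is a GRing.unit,
      forall a, tensor_flip A A (Δ a) = R * Δ a * R^-1,
      tensor_assoc A A A (tensor_map Δ \1 R) = leg13 R * leg23 R
    & tensor_map \1 Δ R = leg13 R * leg12 R].

Definition grouplike g : Prop := g \is a GRing.unit /\ Δ g = g \ox g.

Definition ribbon R g : Prop :=
  [/\ quasitriangular R, grouplike g & forall a, S (S a) = g * a * g^-1].

Definition left_integral Lam : Prop := forall a, a * Lam = (ε a : k) *: Lam.
Definition right_integral Lam : Prop := forall a, Lam * a = (ε a : k) *: Lam.

Definition integral Lam : Prop := left_integral Lam /\ right_integral Lam.

(* \sum_a lam(a_(1)) a_(2) = lam(a) 1.                                        *)
Definition dual_right_integral lam : Prop :=
  forall a, tensor_lift (fun x y => (lam x : k) *: y) (Δ a) = (lam a : k)%:A.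

(* a \ox b |-> \sum_b lam(S(a) b_(1)) b_(2).                                  *)
Definition star_map lam : 'Hom(A ⊗ A, A) :=
  tensor_lift (fun a b =>
    tensor_lift (fun x y => (lam (S a * x) : k) *: y) (Δ b)).

Definition star lam a b : A := star_map lam (a \ox b).

End Hopf.

Definition unimodular (k : fieldType) (A : hopfAlgType k) : Prop :=
  forall Lam : A, left_integral Lam <-> right_integral Lam.

Section CenterQuotient.
Variables (k : fieldType) (A : falgType k) (lam : 'Hom(A, k^o)).

Definition center_alg : falgType k := subvs_of 'Z({:A})%AS.
Local Notation Z := center_alg.
Implicit Types a b c : Z.

Lemma center_algC : commutative (@GRing.mul Z).
Proof.
move=> a b; apply: val_inj => /=.
have := subvsP a; rewrite memv_cap => /andP[_ /centvP ca].
exact/ca/memvf.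
Qed.

Let form a b : k^o := lam (vsval a * vsval b).

Fact center_form_is_linear a : linear (form a).
Proof. by move=> x b c; rewrite /form linearP mulrDr -scalerAr linearP. Qed.
HB.instance Definition _ a := GRing.isSemilinear.Build k Z k^o _ (form a)
  (GRing.semilinear_linear (center_form_is_linear a)).

Definition center_form a : 'Hom(Z, k^o) := linfun (form a).

Fact center_form_linear : linear center_form.
Proof.
move=> x a b; apply/lfunP => c; rewrite add_lfunE scale_lfunE !lfunE /= /form.
by rewrite linearP mulrDl -scalerAl linearP.
Qed.
HB.instance Definition _ := GRing.isSemilinear.Build k Z 'Hom(Z, k^o) _
  center_form (GRing.semilinear_linear center_form_linear).

(* K(A), see center_radicalP.                                                 *)
Definition center_radical : {vspace Z} := lker (linfun center_form).

Lemma center_radicalP a :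
  reflect (forall b, lam (vsval a * vsval b) = 0) (a \in center_radical).
Proof.
rewrite memv_ker lfunE /=; apply: (iffP eqP) => [a0 b | a0].
  by have /lfunP/(_ b) := a0; rewrite !lfunE.
by apply/lfunP => b; rewrite !lfunE; apply: a0.
Qed.

Lemma center_radicalM a b : a \in center_radical -> a * b \in center_radical.
Proof.
move/center_radicalP => a0; apply/center_radicalP => c.
by rewrite -mulrA; apply: (a0 (b * c)).
Qed.

Definition center_quotient : Type := {ideal_quot center_radical}.
Local Notation Q := center_quotient.

HB.instance Definition _ := Choice.on Q.
HB.instance Definition _ := GRing.Zmodule.on Q.
HB.instance Definition _ := EqQuotient.on Q.
HB.instance Definition _ := ZmodQuotient.on Q.

Lemma center_quotientE a b : (a == b %[mod Q]) = (a - b \in center_radical).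
Proof. by rewrite -Quotient.idealrBE. Qed.

Definition center_quotient_scale x : Q -> Q := lift_op1 Q ( *:%R x).

Fact pi_center_scale x : {morph \pi_Q : a / x *: a >-> center_quotient_scale x a}.
Proof.
move=> a; unlock center_quotient_scale; apply/eqP.
by rewrite center_quotientE -scalerBr memvZ // -center_quotientE reprK.
Qed.

Fact center_quotient_scaleA x y q :
  center_quotient_scale x (center_quotient_scale y q)
  = center_quotient_scale (x * y) q.
Proof. by rewrite -[q]reprK -!pi_center_scale scalerA. Qed.

Fact center_quotient_scale1 : left_id 1 center_quotient_scale.
Proof. by move=> q; rewrite -[q]reprK -pi_center_scale scale1r. Qed.

Fact center_quotient_scaleDr : right_distributive center_quotient_scale +%R.
Proof.
move=> x q r; rewrite -[q]reprK -[r]reprK -raddfD -!pi_center_scale.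
by rewrite scalerDr raddfD.
Qed.

Fact center_quotient_scaleDl q :
  {morph center_quotient_scale^~ q : x y / x + y}.
Proof.
by move=> x y; rewrite -[q]reprK -!pi_center_scale scalerDl raddfD.
Qed.

HB.instance Definition _ := GRing.Zmodule_isLmodule.Build k Q
  center_quotient_scaleA center_quotient_scale1 center_quotient_scaleDr
  center_quotient_scaleDl.

Definition center_quotient_mul : Q -> Q -> Q := lift_op2 Q *%R.

Fact pi_center_mul : {morph \pi_Q : a b / a * b >-> center_quotient_mul a b}.
Proof.
move=> a b; unlock center_quotient_mul; apply/eqP; rewrite center_quotientE.
set a' := repr _; set b' := repr _.
have -> : a * b - a' * b' = (a - a') * b + (b - b') * a'.
  by rewrite !mulrBl addrA [b * a']center_algC subrK [b' * _]center_algC.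
by rewrite memvD // center_radicalM // -center_quotientE reprK.
Qed.

Fact center_quotient_mulA : associative center_quotient_mul.
Proof.
by move=> q r s; rewrite -[q]reprK -[r]reprK -[s]reprK -!pi_center_mul mulrA.
Qed.

Fact center_quotient_mulC : commutative center_quotient_mul.
Proof.
by move=> q r; rewrite -[q]reprK -[r]reprK -!pi_center_mul center_algC.
Qed.

Fact center_quotient_mul1 : left_id (\pi_Q 1) center_quotient_mul.
Proof. by move=> q; rewrite -[q]reprK -!pi_center_mul mul1r. Qed.

Fact center_quotient_mulDl : left_distributive center_quotient_mul +%R.
Proof.
move=> q r s; rewrite -[q]reprK -[r]reprK -[s]reprK.
by rewrite -!raddfD -!pi_center_mul mulrDl -raddfD.
Qed.

(* The zero ring is allowed: Q = 0 when lam vanishes on the centre.           *)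
HB.instance Definition _ := GRing.Zmodule_isComPzRing.Build Q
  center_quotient_mulA center_quotient_mulC center_quotient_mul1
  center_quotient_mulDl.

End CenterQuotient.

(* Main.v *)
(** The right-integral property of lam gives the second formula
    [a * b = \sum lam (S(a_2) b) a_1] for the star product, and comparing the
    two formulas yields associativity on all of A.  The integral Lam is a
    two-sided identity; expanding x by [Lam * x = x] along the first leg of
    [Delta Lam], and S y as [\sum lam (Lam_1 y) Lam_2] along the second, gives
    [lam (x y) = lam (S^2(y) x)], from which centrality of products of central
    elements and the antipode formula follow.

    For the quotient, R commutes with g ⊗ g and S^2 is conjugation by g, so
    [lam(w _) ⊗ lam(w' _)] takes the same value on [R t R^-1] and on t when w
    and w' are central; hence it is symmetric on Delta b.  Taking b = Lam gives
    [lam (S w) = lam w] on the centre, and then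
    [lam (c (a * b)) = lam (c (b * a))]. *)

From HB Require Import structures.
From mathcomp Require Import all_boot all_order all_algebra all_field.
From mathcomp Require Import generic_quotient ring_quotient.
(* Defs comes last: otherwise its linear instance for maps of the form
   [fun_of_lfun _] hides the library's one and [linearP] fails on 'Hom. *)
Require Import Defs.

Set Implicit Arguments.
Unset Strict Implicit.
Unset Printing Implicit Defensive.

Import GRing.Theory.
Local Open Scope ring_scope.
Local Open Scope quotient_scope.

(** * Linear maps and tensor products *)

Section Multilinear.
Variable k : fieldType.

Section Module.
Variables U V W : lmodType k.

Lemma linear_sum_fun (f : U -> V) (I : Type) (r : seq I) (F : I -> U) :
  linear f -> f (\sum_(i <- r) F i) = \sum_(i <- r) f (F i).
Proof.
move=> fL; have f0 : f 0 = 0.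
  by have := fL (-1) 0 0; rewrite !scaleN1r oppr0 addr0 addNr.
elim/big_rec2: _ => // i y1 y2 _ <-.
by have := fL 1 (F i) y2; rewrite !scale1r.
Qed.

Lemma linear_scale_fun (f : U -> V) c u : linear f -> f (c *: u) = c *: f u.
Proof.
move=> fL; have f0 : f 0 = 0.
  by have := fL (-1) 0 0; rewrite !scaleN1r oppr0 addr0 addNr.
by have := fL c u 0; rewrite f0 !addr0.
Qed.

Lemma linear_id_fun : linear (fun u : U => u).
Proof. by []. Qed.

Lemma linear_comp_fun (f : V -> W) (g : U -> V) :
  linear f -> linear g -> linear (fun u => f (g u)).
Proof. by move=> fL gL c u v; rewrite gL fL. Qed.

Lemma linear_scaler_fun (f : U -> V) c : linear f -> linear (fun u => c *: f u).
Proof. by move=> fL d u v; rewrite fL scalerDr !scalerA mulrC. Qed.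

Lemma linear_scalel_fun (f : U -> k^o) (v : V) :
  linear f -> linear (fun u => (f u : k) *: v).
Proof. by move=> fL d u w; rewrite fL scalerDl scalerA. Qed.

End Module.

Lemma linear_lfun (U V : vectType k) (f : 'Hom(U, V)) : linear f.
Proof. by move=> c u v; rewrite linearP. Qed.

Lemma linear_mull_fun (U : lmodType k) (B : algType k) (f : U -> B) b :
  linear f -> linear (fun u => b * f u).
Proof. by move=> fL c u v; rewrite fL mulrDr scalerAr. Qed.

Lemma linear_mulr_fun (U : lmodType k) (B : algType k) (f : U -> B) b :
  linear f -> linear (fun u => f u * b).
Proof. by move=> fL c u v; rewrite fL mulrDl scalerAl. Qed.

Lemma linear_tensorl_fun (T : lmodType k) (U V : vectType k) (f : T -> U) v :
  linear f -> linear (fun t => f t \ox v : U ⊗ V).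
Proof. by move=> fL c x y; rewrite fL pure_tensor_linearl. Qed.

Lemma linear_tensorr_fun (T : lmodType k) (U V : vectType k) (f : T -> V) u :
  linear f -> linear (fun t => u \ox f t : U ⊗ V).
Proof. by move=> fL c x y; rewrite fL pure_tensor_linearr. Qed.

Section Lift.
Variables (U V W : vectType k).

Lemma tensor_lift_map (W' : vectType k) (h : W -> W') (f : U -> V -> W) t :
  linear h -> h (tensor_lift f t) = tensor_lift (fun x y => h (f x y)) t.
Proof.
move=> hL; rewrite !lfunE /= /tensor_lift_fun (linear_sum_fun _ _ hL).
apply: eq_bigr => i _; rewrite (linear_sum_fun _ _ hL).
by apply: eq_bigr => j _; rewrite (linear_scale_fun _ _ hL).
Qed.

Lemma eq_tensor_lift (f g : U -> V -> W) t :
  (forall x y, f x y = g x y) -> tensor_lift f t = tensor_lift g t.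
Proof.
move=> fg; rewrite !lfunE /= /tensor_lift_fun.
by apply: eq_bigr => i _; apply: eq_bigr => j _; rewrite fg.
Qed.

(** Pure tensors span [U ⊗ V]. Linearity is asked of bare functions, so that the rule applies to
    lambda-terms without packing them into ['Hom]. *)
Lemma eq_linear_tensor (f g : U ⊗ V -> W) t :
    linear f -> linear g ->
  (forall u v, f (u \ox v) = g (u \ox v)) -> f t = g t.
Proof.
move=> fL gL fg; rewrite (tensor_sum t) (linear_sum_fun _ _ fL).
rewrite (linear_sum_fun _ _ gL); apply: eq_bigr => i _.
rewrite (linear_sum_fun _ _ fL) (linear_sum_fun _ _ gL).
by apply: eq_bigr => j _;
  rewrite (linear_scale_fun _ _ fL) (linear_scale_fun _ _ gL) fg.
Qed.

Lemma linear_tensor_lift_fun (T : lmodType k) (F : T -> U -> V -> W) t :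
  (forall x y, linear (fun z => F z x y)) ->
  linear (fun z => tensor_lift (F z) t).
Proof.
move=> FL c u v; rewrite !lfunE /= /tensor_lift_fun scaler_sumr -big_split /=.
apply: eq_bigr => i _; rewrite scaler_sumr -big_split /=.
by apply: eq_bigr => j _; rewrite FL scalerDr !scalerA mulrC.
Qed.

(** By definition [tensor_lift] is a coordinate sum, so both sides are the same fourfold sum over
    basis vectors, taken in two orders. *)
Lemma tensor_lift_swap (U' V' : vectType k) (F : U -> V -> U' -> V' -> W) t t' :
  tensor_lift (fun x y => tensor_lift (F x y) t') t =
  tensor_lift (fun u v => tensor_lift (fun x y => F x y u v) t) t'.
Proof.
transitivity (tensor_lift_fun (fun x y => tensor_lift_fun (F x y) t') t).
  by rewrite lfunE /=; apply: eq_bigr => i _; apply: eq_bigr => j _;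
    rewrite lfunE.
transitivity (tensor_lift_fun (fun u v => tensor_lift_fun (fun x y =>
  F x y u v) t) t');
  last first.
  by rewrite lfunE /=; apply: eq_bigr => i _; apply: eq_bigr => j _;
    rewrite lfunE.
rewrite /tensor_lift_fun.
under eq_bigr => i _ do under eq_bigr => j _ do rewrite scaler_sumr.
under [RHS]eq_bigr => i _ do under eq_bigr => j _ do rewrite scaler_sumr.
rewrite pair_bigA [RHS]pair_bigA /=.
under eq_bigr => p _ do under eq_bigr => q _ do rewrite scaler_sumr.
under [RHS]eq_bigr => p _ do under eq_bigr => q _ do rewrite scaler_sumr.
under eq_bigr => p _ do rewrite pair_bigA /=.
under [RHS]eq_bigr => p _ do rewrite pair_bigA /=.
rewrite exchange_big; apply: eq_bigr => p _; apply: eq_bigr => q _.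
by rewrite !scalerA mulrC.
Qed.

End Lift.
End Multilinear.

Lemma linear_lfun_fun (k : fieldType) (T : lmodType k) (U V : vectType k)
    (h : 'Hom(U, V)) (f : T -> U) :
  linear f -> linear (fun t => h (f t)).
Proof. exact/linear_comp_fun/linear_lfun. Qed.

(** * Sweedler sums *)

(** For bilinear [f] this is $\sum f(a_{(1)},a_{(2)})$. For other [f] the value depends on the
    chosen bases, whence the linearity side conditions of the calculus below. *)
Definition sweedler (k : fieldType) (A : hopfAlgType k) (W : vectType k)
  (f : A -> A -> W) (a : A) : W := tensor_lift f (comul a).

Notation "\Delta_ ( x , y <- a ) E" := (sweedler (fun x y => E) a)
  (at level 41, E at level 41, x name, y name, a at level 50,
   format "\Delta_ ( x ,  y  <-  a )  E").

Section SweedlerSums.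
Variables (k : fieldType) (A : hopfAlgType k) (W : vectType k).

Lemma eq_sweedler (f g : A -> A -> W) a :
  (forall x y, f x y = g x y) -> sweedler f a = sweedler g a.
Proof. exact: eq_tensor_lift. Qed.

Lemma sweedler_map (W' : vectType k) (h : W -> W') (f : A -> A -> W) a :
  linear h -> h (sweedler f a) = \Delta_(x, y <- a) h (f x y).
Proof. exact: tensor_lift_map. Qed.

Lemma linear_sweedler (T : lmodType k) (F : T -> A -> A -> W) a :
    (forall x y, linear (fun z => F z x y)) ->
  linear (fun z => sweedler (F z) a).
Proof. exact: linear_tensor_lift_fun. Qed.

Lemma linear_sweedler_arg (T : lmodType k) (f : A -> A -> W) (g : T -> A) :
  linear g -> linear (fun z => sweedler f (g z)).
Proof.
by move=> gL; apply: linear_lfun_fun; apply: linear_lfun_fun.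
Qed.

Lemma sweedler_swap (B : hopfAlgType k) (F : A -> A -> B -> B -> W) a b :
  \Delta_(x, y <- a) \Delta_(u, v <- b) F x y u v =
  \Delta_(u, v <- b) \Delta_(x, y <- a) F x y u v.
Proof. exact: tensor_lift_swap. Qed.

End SweedlerSums.

(** Discharges linearity side conditions by recursion on the head symbol of the body. The branches
    for products, scalings and pure tensors match only if the bound variable occurs in just one
    factor. *)
Ltac linear_tac := intros; cbv beta; match goal with
  | |- GRing.linear_for _ (fun x => x) => exact: linear_id_fun
  | |- GRing.linear_for _ (fun x => sweedler (@?F x) ?t) =>
      apply: linear_sweedler; linear_tac
  | |- GRing.linear_for _ (fun x => sweedler ?F (@?f x)) =>
      apply: linear_sweedler_arg; linear_tac
  | |- GRing.linear_for _ (fun x => fun_of_lfun (tensor_lift (@?F x)) ?t) =>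
      apply: linear_tensor_lift_fun; linear_tac
  | |- GRing.linear_for _ (fun x => fun_of_lfun ?h (@?f x)) =>
      first [exact: linear_lfun | apply: linear_lfun_fun; linear_tac]
  | |- GRing.linear_for _ (fun x => GRing.scale ?c (@?f x)) =>
      apply: linear_scaler_fun; linear_tac
  | |- GRing.linear_for _ (fun x => GRing.scale (@?f x) ?v) =>
      apply: linear_scalel_fun; linear_tac
  | |- GRing.linear_for _ (fun x => GRing.mul ?c (@?f x)) =>
      apply: linear_mull_fun; linear_tac
  | |- GRing.linear_for _ (fun x => GRing.mul (@?f x) ?c) =>
      apply: linear_mulr_fun; linear_tac
  | |- GRing.linear_for _ (fun x => pure_tensor ?u (@?f x)) =>
      apply: linear_tensorr_fun; linear_tac
  | |- GRing.linear_for _ (fun x => pure_tensor (@?f x) ?u) =>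
      apply: linear_tensorl_fun; linear_tac
  | |- GRing.linear_for _ (fun x => _) => solve [auto]
  | |- GRing.linear_for _ (fun_of_lfun _) => exact: linear_lfun
  | |- GRing.linear_for ?s ?f => lazymatch f with
      | fun x => _ => fail
      | _ => change (GRing.linear_for s (fun x => f x)); linear_tac
      end
  end.

(** Both sides are bilinear in [s] and [t], and on pure tensors the claim is [tensor_mulE]. *)
Lemma tensor_liftM (k : fieldType) (A B : falgType k) (W : vectType k)
    (f : A -> B -> W) (s t : A ⊗ B) :
    (forall y, linear (f^~ y)) -> (forall x, linear (f x)) ->
  tensor_lift f (s * t) =
  tensor_lift (fun x y => tensor_lift (fun u v => f (x * u) (y * v)) t) s.
Proof.
move=> fl fr.
have fml y z : linear (fun x => f (x * y) z).
  exact: linear_comp_fun (fl _) (linear_mulr_fun _ (linear_id_fun (U:=A))).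
have fmr x y : linear (fun z => f x (z * y)).
  exact: linear_comp_fun (fr _) (linear_mulr_fun _ (linear_id_fun (U:=B))).
have fnl y z : linear (fun x => f (y * x) z).
  exact: linear_comp_fun (fl _) (linear_mull_fun _ (linear_id_fun (U:=A))).
have fnr x y : linear (fun z => f x (y * z)).
  exact: linear_comp_fun (fr _) (linear_mull_fun _ (linear_id_fun (U:=B))).
apply: (eq_linear_tensor (f := fun s => tensor_lift f (s * t)));
  try by linear_tac.
move=> a b.
rewrite tensor_liftE; [|by linear_tac|by linear_tac].
apply: (eq_linear_tensor (f := fun t => tensor_lift f ((a \ox b) * t)));
  try by linear_tac.
by move=> u v; rewrite [_ * _]tensor_mulE !tensor_liftE.
Qed.

Lemma pure_tensorM (k : fieldType) (A B : falgType k) (a c : A) (b d : B) :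
  (a \ox b) * (c \ox d) = (a * c) \ox (b * d) :> A ⊗ B.
Proof. exact: tensor_mulE. Qed.

Lemma tensor_lift_pure (k : fieldType) (U V : vectType k) (t : U ⊗ V) :
  tensor_lift (fun u v => u \ox v) t = t.
Proof.
apply: (eq_linear_tensor (g := fun t => t)); [exact: linear_lfun|by []|].
by move=> u v; rewrite tensor_liftE //; linear_tac.
Qed.

Section Sweedler.
Variables (k : fieldType) (A : hopfAlgType k).
Implicit Types a b c x y z : A.
Local Notation S := (@antipode k A).
Local Notation ε := (@counit k A).

Section Rules.
Variable W : vectType k.

Lemma sweedlerA (F : A -> A -> A -> W) a :
    (forall y z, linear (fun x => F x y z)) ->
    (forall x z, linear (fun y => F x y z)) ->
    (forall x y, linear (fun z => F x y z)) ->
  \Delta_(x, z <- a) \Delta_(u, v <- x) F u v z =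
  \Delta_(u, y <- a) \Delta_(v, z <- y) F u v z.
Proof.
move=> F1 F2 F3.
change (tensor_lift (fun x z : A => tensor_lift (fun u v => F u v z) (comul x))
    (comul a) =
  tensor_lift (fun u y : A => tensor_lift (fun v z => F u v z) (comul y))
    (comul a)).
(* The trilinear [F] becomes one linear map on the right-bracketed triple tensor product, ready to
   be applied to [comulA]. *)
pose G : 'Hom(A ⊗ (A ⊗ A), W) := tensor_lift (fun x t => tensor_lift (F x) t).
have GE x y z : G (x \ox (y \ox z)) = F x y z.
  rewrite tensor_liftE; first by rewrite tensor_liftE.
    by move=> t c u v; rewrite (linear_tensor_lift_fun (F := F)).
  by move=> u; linear_tac.
have := congr1 G (comulA a); rewrite /tensor_map.
rewrite (tensor_lift_map _ _ (linear_lfun (tensor_assoc A A A))).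
rewrite !(tensor_lift_map _ _ (linear_lfun G)) => E.
transitivity (tensor_lift (fun x y : A =>
    G (tensor_assoc A A A (comul x \ox \1%VF y))) (comul a)).
  apply: eq_tensor_lift => x z; rewrite id_lfunE.
  rewrite tensor_liftE; [|by linear_tac|by linear_tac].
  rewrite (tensor_lift_map _ _ (linear_lfun G)).
  by apply: eq_tensor_lift => u v; rewrite GE.
rewrite E; apply: eq_tensor_lift => x z; rewrite id_lfunE tensor_liftE.
- exact: eq_tensor_lift.
- by move=> t c u v; rewrite (linear_tensor_lift_fun (F := F)).
- by move=> u; linear_tac.
Qed.

(** The summand [h] is kept apart from [f]: it need only equal [ε x *: f y] pointwise, and that
    equation is often proved by contracting an inner sum. The three rules below have the same
    shape. *)
Lemma sweedler_counitl (f : A -> W) (h : A -> A -> W) a :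
    linear f -> (forall x y, h x y = (ε x : k) *: f y) ->
  \Delta_(x, y <- a) h x y = f a.
Proof.
move=> fL hE; rewrite /sweedler -[in RHS](counitl a) (tensor_lift_map _ _ fL).
by apply: eq_tensor_lift => x y; rewrite hE linear_scale_fun.
Qed.

Lemma sweedler_counitr (f : A -> W) (h : A -> A -> W) a :
    linear f -> (forall x y, h x y = (ε y : k) *: f x) ->
  \Delta_(x, y <- a) h x y = f a.
Proof.
move=> fL hE; rewrite /sweedler -[in RHS](counitr a) (tensor_lift_map _ _ fL).
by apply: eq_tensor_lift => x y; rewrite hE linear_scale_fun.
Qed.

Lemma sweedler_antipodel (f : A -> W) (h : A -> A -> W) a :
    linear f -> (forall x y, h x y = f (S x * y)) ->
  \Delta_(x, y <- a) h x y = (ε a : k) *: f 1.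
Proof.
move=> fL hE; rewrite /sweedler -(linear_scale_fun _ _ fL) -antipodel.
by rewrite (tensor_lift_map _ _ fL); apply: eq_tensor_lift => x y; rewrite hE.
Qed.

Lemma sweedler_antipoder (f : A -> W) (h : A -> A -> W) a :
    linear f -> (forall x y, h x y = f (x * S y)) ->
  \Delta_(x, y <- a) h x y = (ε a : k) *: f 1.
Proof.
move=> fL hE; rewrite /sweedler -(linear_scale_fun _ _ fL) -antipoder.
by rewrite (tensor_lift_map _ _ fL); apply: eq_tensor_lift => x y; rewrite hE.
Qed.

Lemma sweedlerM (f : A -> A -> W) a b :
    (forall y, linear (f^~ y)) -> (forall x, linear (f x)) ->
  \Delta_(x, y <- a * b) f x y =
  \Delta_(x, y <- a) \Delta_(u, v <- b) f (x * u) (y * v).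
Proof.
move=> fl fr; rewrite /sweedler;
  have -> : comul (a * b) = comul a * comul b :> A ⊗ A.
  exact: rmorphM.
exact: tensor_liftM.
Qed.

End Rules.
End Sweedler.

(** * The antipode *)

Section Antipode.
Variables (k : fieldType) (A : hopfAlgType k).
Implicit Types a b c x y z : A.
Local Notation S := (@antipode k A).
Local Notation ε := (@counit k A).

Lemma counitM a b : ε (a * b) = (ε a : k) * (ε b : k) :> k.
Proof. by rewrite (rmorphM ε). Qed.

(* Both sides are convolution inverses of the multiplication A ⊗ A -> A. *)
Lemma antipodeM a b : S (a * b) = S b * S a.
Proof.
(* The summand of the triple convolution of $S\circ m$, $m$ and $(x,y)\mapsto S(y)S(x)$. Bracketed
   to the right it contracts to $S(ab)$, to the left to $S(b)S(a)$. *)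
pose G x1 x2 x3 y1 y2 y3 : A := S (x1 * y1) * (x2 * y2 * (S y3 * S x3)).
have E : \Delta_(x1, x' <- a) \Delta_(x2, x3 <- x')
      \Delta_(y1, y' <- b) \Delta_(y2, y3 <- y') G x1 x2 x3 y1 y2 y3 =
    \Delta_(w, x3 <- a) \Delta_(x1, x2 <- w)
      \Delta_(v, y3 <- b) \Delta_(y1, y2 <- v) G x1 x2 x3 y1 y2 y3.
  rewrite -sweedlerA; [|by rewrite /G; linear_tac ..].
  apply: eq_sweedler => w x3; apply: eq_sweedler => x1 x2.
  by rewrite -sweedlerA //; rewrite /G; linear_tac.
transitivity (\Delta_(x1, x' <- a) \Delta_(x2, x3 <- x')
      \Delta_(y1, y' <- b) \Delta_(y2, y3 <- y') G x1 x2 x3 y1 y2 y3).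
  symmetry; apply: (sweedler_counitr (f := fun x => S (x * b)));
    first by linear_tac.
  move=> x1 x'; rewrite sweedler_swap.
  apply: (sweedler_counitr (f := fun y => (ε x' : k) *: S (x1 * y)));
    first by linear_tac.
  move=> y1 y'.
  pose f x := (ε y' : k) *: (S (x1 * y1) * x).
  rewrite (sweedler_antipoder
    (f := f)) ?/f ?mulr1 1?scalerA 1?mulrC -?scalerA //.
    by linear_tac.
  move=> x2 x3.
  rewrite (sweedler_antipoder (f := fun y => S (x1 * y1) * (x2 * y * S x3))).
  - by rewrite mulr1.
  - by linear_tac.
  - by move=> y2 y3; rewrite /G !mulrA.
rewrite E; apply: (sweedler_counitl (f := fun x => S b * S x));
  first by linear_tac.
move=> w x3; rewrite sweedler_swap.
apply: (sweedler_counitl (f := fun y => (ε w : k) *: (S y * S x3))).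
  by linear_tac.
move=> v y3; rewrite -(sweedlerM (f := fun x y => S x * (y * (S y3 * S x3))));
  [|by linear_tac ..].
rewrite (sweedler_antipodel (f := fun x => x * (S y3 * S x3))) ?mul1r.
- by rewrite counitM !scalerA mulrC.
- by linear_tac.
- by move=> x y; rewrite !mulrA.
Qed.

(** Apply [ε] to $\sum S(a_{(1)})a_{(2)}=\epsilon(a)1$; multiplicativity and the counit axiom reduce
    the left side to $\epsilon(S(a))$. *)
Lemma counit_antipode a : ε (S a) = ε a.
Proof.
have : \Delta_(x, y <- a) ε (S x * y) = (ε a : k) *: ε 1.
  by apply: (sweedler_antipodel (f := ε)) => //; linear_tac.
rewrite rmorph1 [RHS]mulr1 => <-; symmetry.
apply: (sweedler_counitr (f := fun x => ε (S x))); first by linear_tac.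
by move=> x y; rewrite (rmorphM ε) mulrC.
Qed.

Lemma comulE a : comul a = \Delta_(x, y <- a) x \ox y.
Proof. by rewrite /sweedler tensor_lift_pure. Qed.

Let flip_antipode a : A ⊗ A := \Delta_(x, y <- a) (S y \ox S x).

(** The candidate for $\Delta(S(a))$ is a right convolution inverse of [comul]: among the four legs
    of $a$, the inner pair $a_{(2)}S(a_{(3)})$ contracts first, then the outer pair
    $a_{(1)}S(a_{(4)})$. *)
Lemma comul_flip_antipode a :
  \Delta_(x, y <- a) (comul x * flip_antipode y : A ⊗ A) =
    (ε a : k) *: (1 \ox 1).
Proof.
pose F u v s : A ⊗ A := \Delta_(p, q <- s) ((u * S q) \ox (v * S p)).
transitivity (\Delta_(x, s <- a) \Delta_(u, v <- x) F u v s).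
  apply: eq_sweedler => x s; rewrite comulE.
  rewrite (sweedler_map _ _ (h := fun t : A ⊗ A => t * flip_antipode s));
    last by linear_tac.
  apply: eq_sweedler => u v.
  rewrite (sweedler_map _ _ (h := fun t : A ⊗ A => u \ox v * t));
    last by linear_tac.
  by apply: eq_sweedler => p q; rewrite pure_tensorM.
rewrite sweedlerA; [|by rewrite /F; linear_tac ..].
apply: (sweedler_antipoder (f := fun x => x \ox 1)); first by linear_tac.
move=> u t; rewrite /F -sweedlerA; [|by linear_tac ..].
apply: (sweedler_counitl (f := fun q => (u * S q) \ox 1)); first by linear_tac.
move=> c q; apply: (sweedler_antipoder (f := fun y => (u * S q) \ox y)) => //.
by linear_tac.
Qed.

(* Both sides are convolution inverses of comul : A -> A ⊗ A. *)
Lemma comul_antipode a : comul (S a) = \Delta_(x, y <- a) S y \ox S x.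
Proof.
(* A triple convolution again: the left bracketing contracts to [flip_antipode a], the right one to
   [comul (S a)]. *)
pose F x y z : A ⊗ A := comul (S x) * (comul y * flip_antipode z).
have : \Delta_(w, z <- a) \Delta_(x, y <- w) F x y z =
    \Delta_(x, w <- a) \Delta_(y, z <- w) F x y z.
  by rewrite (sweedlerA (F := F)) // => *; rewrite /F /flip_antipode;
    linear_tac.
rewrite (sweedler_counitl (f := flip_antipode)); last first.
- move=> w z.
  rewrite (sweedler_antipodel
    (f := fun x : A => (comul x : A ⊗ A) * flip_antipode z)).
  + by rewrite rmorph1 mul1r.
  + by rewrite /flip_antipode; linear_tac.
  + by move=> x y; rewrite /F mulrA (rmorphM comul).
- by rewrite /flip_antipode; linear_tac.
move=> E; symmetry; apply: etrans E _.
apply: (sweedler_counitr (f := fun x : A => (comul (S x) : A ⊗ A)));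
  first by linear_tac.
move=> x w; rewrite /F.
rewrite -(sweedler_map _ _ (h := fun t : A ⊗ A => comul (S x) * t));
  last by linear_tac.
by rewrite comul_flip_antipode -scalerAr mulr1.
Qed.

End Antipode.

(** * The star product *)

Section Star.
Variables (k : fieldType) (A : hopfAlgType k).
Implicit Types a b c x y z : A.
Local Notation S := (@antipode k A).
Local Notation ε := (@counit k A).

Lemma scale_regularE (V : lmodType k) (c : k) (d : k^o) (v : V) :
  ((c *: d : k^o) : k) *: v = c *: ((d : k) *: v).
Proof. by rewrite scalerA. Qed.

Lemma antipode1 : S 1 = 1.
Proof.
have := antipodel (1 : A); rewrite !rmorph1 tensor_liftE; [|by linear_tac ..].
by rewrite mulr1 scale1r.
Qed.

Lemma sweedler_antipode (W : vectType k) (f : A -> A -> W) a :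
    (forall y, linear (f^~ y)) -> (forall x, linear (f x)) ->
  \Delta_(x, y <- S a) f x y = \Delta_(x, y <- a) f (S y) (S x).
Proof.
move=> fl fr; rewrite /sweedler comul_antipode.
rewrite (sweedler_map _ _ (linear_lfun (tensor_lift f))).
by apply: eq_sweedler => x y; rewrite tensor_liftE.
Qed.

Section DualIntegral.
Variable lam : 'Hom(A, k^o).

Lemma starE a b : star lam a b = \Delta_(x, y <- b) ((lam (S a * x) : k) *: y).
Proof. by rewrite /star /star_map tensor_liftE // => *; linear_tac. Qed.

Lemma linear_starl b : linear (fun a => star lam a b).
Proof.
have starL : linear (fun a => \Delta_(x, y <- b) ((lam (S a * x) : k) *: y)).
  by linear_tac.
by move=> c x y; rewrite !starE starL.
Qed.

Lemma linear_starr a : linear (fun b => star lam a b).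
Proof.
have starL : linear (fun b => \Delta_(x, y <- b) ((lam (S a * x) : k) *: y)).
  by linear_tac.
by move=> c x y; rewrite !starE starL.
Qed.

Hypothesis lamP : dual_right_integral lam.

Lemma dual_integralE a : \Delta_(x, y <- a) ((lam x : k) *: y) = (lam a : k)%:A.
Proof. exact: lamP. Qed.

(* Expand [lam (S y * b) 1] by the integral property of lam at S y * b. *)
Lemma starE2 a b : star lam a b = \Delta_(x, y <- a) ((lam (S y * b) : k) *: x).
Proof.
(* The factor $xS(y)$ is inserted before [v]. Contracting it gives back $a\star b$; bracketed the
   other way, the sum over $y,z$ is $x$ times an instance of the integral property. *)
pose F x y z : A := \Delta_(u, v <- b) ((lam (S z * u) : k) *: (x * S y * v)).
transitivity (\Delta_(w, z <- a) \Delta_(x, y <- w) F x y z).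
  symmetry; apply: (sweedler_counitl (f := fun z => star lam z b)).
    exact: linear_starl.
  move=> w z; rewrite starE.
  rewrite (sweedler_antipoder
    (f := fun x => \Delta_(u, v <- b) ((lam (S z * u) : k) *: (x * v)))) //.
    by congr (_ *: _); apply: eq_sweedler => u v; rewrite mul1r.
  by linear_tac.
rewrite sweedlerA; [|by rewrite /F => *; linear_tac ..].
apply: eq_sweedler => x w.
transitivity (x * (lam (S w * b) : k)%:A); last by rewrite -scalerAr mulr1.
rewrite -dual_integralE sweedlerM; [|by linear_tac ..].
rewrite sweedler_antipode; [|by linear_tac ..].
rewrite (sweedler_map _ _ (h := fun t : A => x * t)); last by linear_tac.
apply: eq_sweedler => y z.
rewrite (sweedler_map _ _ (h := fun t : A => x * t)); last by linear_tac.
by apply: eq_sweedler => u v; rewrite -scalerAr mulrA.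
Qed.

(** A mirror image of [starE2]: expand $\lambda(aw)1$ by the integral property at $aw$, multiply by
    $S(z)$ on the right and contract $yS(z)$. At $a=\Lambda$ it yields the expansion of [S y] in
    [nakayama]. *)
Lemma dual_integral_antipode a b :
  \Delta_(x, y <- a) ((lam (x * b) : k) *: y) =
  \Delta_(x, y <- b) ((lam (a * x) : k) *: S y).
Proof.
pose F x y z : A := \Delta_(u, v <- a) ((lam (u * x) : k) *: (v * y * S z)).
transitivity (\Delta_(x, w <- b) \Delta_(y, z <- w) F x y z).
  symmetry; apply: (sweedler_counitr
    (f := fun x => \Delta_(u, v <- a) ((lam (u * x) : k) *: v))).
    by linear_tac.
  move=> x w.
  rewrite (sweedler_antipoder
    (f := fun y => \Delta_(u, v <- a) ((lam (u * x) : k) *: (v * y)))).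
  - by congr (_ *: _); apply: eq_sweedler => u v; rewrite mulr1.
  - by linear_tac.
  - by move=> y z; rewrite /F; apply: eq_sweedler => u v; rewrite mulrA.
rewrite -sweedlerA; [|by rewrite /F => *; linear_tac ..].
apply: eq_sweedler => w z.
transitivity ((lam (a * w) : k)%:A * S z); last by rewrite -scalerAl mul1r.
rewrite -dual_integralE sweedlerM; [|by linear_tac ..].
rewrite (sweedler_map _ _ (h := fun t : A => t * S z)); last by linear_tac.
rewrite /F sweedler_swap; apply: eq_sweedler => u v.
rewrite (sweedler_map _ _ (h := fun t : A => t * S z)); last by linear_tac.
by apply: eq_sweedler => x y; rewrite -scalerAl.
Qed.

Lemma starA : associative (star lam).
Proof.
move=> a b c; rewrite [star lam b c]starE.
rewrite (sweedler_map _ _ (linear_starr a)).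
transitivity (\Delta_(x, w <- c) \Delta_(y, z <- w)
    ((lam (S b * x) : k) *: ((lam (S a * y) : k) *: z))).
  apply: eq_sweedler => x w;
    rewrite (linear_scale_fun _ _ (linear_starr a)) starE.
  by rewrite (sweedler_map _ _ (h := fun t : A => (lam (S b * x) : k) *: t));
    last by linear_tac.
rewrite -sweedlerA; [|by linear_tac ..].
rewrite [star lam a b]starE (sweedler_map _ _ (linear_starl c)).
transitivity (\Delta_(u, v <- b) \Delta_(w, z <- c)
    ((lam (S a * u) : k) *: ((lam (S v * w) : k) *: z))); last first.
  apply: eq_sweedler => u v;
    rewrite (linear_scale_fun _ _ (linear_starl c)) starE.
  by rewrite (sweedler_map _ _ (h := fun t : A => (lam (S a * u) : k) *: t));
    last by linear_tac.
rewrite sweedler_swap; apply: eq_sweedler => w z.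
(* Both coefficients of [z] are $\lambda(S(a)(b\star w))$, with $b\star w$ written once by [starE]
   and once by [starE2]. *)
transitivity ((lam (S a * star lam b w) : k) *: z).
  rewrite starE (sweedler_map _ _
    (h := fun t : A => (lam (S a * t) : k) *: z)); last by linear_tac.
  by apply: eq_sweedler => x y;
    rewrite -scalerAr (linear_scale_fun _ _ (linear_lfun lam)) scale_regularE.
rewrite starE2 (sweedler_map _ _ (h := fun t : A => (lam (S a * t) : k) *: z));
  last by linear_tac.
apply: eq_sweedler => x y;
  rewrite -scalerAr (linear_scale_fun _ _ (linear_lfun lam)) scale_regularE.
by rewrite !scalerA mulrC.
Qed.

End DualIntegral.
End Star.

(** * Integrals and the centre *)

Section Integral.
Variables (k : fieldType) (A : hopfAlgType k).
Implicit Types a b x y z : A.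
Local Notation S := (@antipode k A).
Local Notation ε := (@counit k A).

Variables (lam : 'Hom(A, k^o)) (Lam g : A) (R : A ⊗ A).
Hypothesis lamP : dual_right_integral lam.
Hypothesis LamP : integral Lam.
Hypothesis lam_Lam : lam Lam = 1.
Hypothesis ribbonRg : ribbon R g.

(** Stated on elements of [A], so that [S] and [star lam] apply directly; [memv_center] translates
    it into membership in the centre. *)
Let central z : Prop := forall x, z * x = x * z.

Lemma lam_scale (c : k) x : lam ((c : k) *: x) = (c : k) *: lam x.
Proof. exact: linear_scale_fun (linear_lfun lam). Qed.

Lemma star_integralr a : star lam a Lam = a.
Proof.
rewrite (starE2 lamP); apply: (sweedler_counitr (f := id)) => // x y.
rewrite LamP.1 lam_scale lam_Lam counit_antipode; congr (_ *: _); exact: mulr1.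
Qed.

Lemma antipode_sqr a : S (S a) = g * a * g^-1.
Proof. by case: ribbonRg. Qed.

Lemma grouplike_unit : g \is a GRing.unit.
Proof. by case: ribbonRg => _ []. Qed.

(** $S^2$ is conjugation by [g], hence onto, and $S(g^{-1}ag)$ is a preimage. Identities can thus be
    tested on elements of the form [S y]. *)
Lemma antipode_surj a : exists b, a = S b.
Proof.
exists (S (g^-1 * a * g)); rewrite antipode_sqr !mulrA mulrV ?grouplike_unit //.
by rewrite mul1r mulrK ?grouplike_unit.
Qed.

Lemma antipode_sqr_central z : central z -> S (S z) = z.
Proof. by move=> zC; rewrite antipode_sqr -zC mulrK ?grouplike_unit. Qed.

Lemma central_antipode z : central z -> central (S z).
Proof.
by move=> zC x; have [y ->] := antipode_surj x; rewrite -!antipodeM zC.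
Qed.

Lemma centralM y z : central y -> central z -> central (y * z).
Proof. by move=> yC zC x; rewrite mulrA -yC -mulrA -zC !mulrA yC. Qed.

Lemma central_integral : central Lam.
Proof. by move=> x; rewrite LamP.1 LamP.2. Qed.

Lemma integral_antipode_mulr x : S Lam * x = (ε x : k) *: S Lam.
Proof.
have [y ->] := antipode_surj x.
by rewrite -antipodeM LamP.1 linearZ /= counit_antipode.
Qed.

Lemma star_integrall_scale b : star lam Lam b = (lam (S Lam) : k) *: b.
Proof.
rewrite starE; apply: (sweedler_counitl (f := fun x => (lam (S Lam) : k) *: x)).
  by linear_tac.
move=> x y; rewrite integral_antipode_mulr lam_scale.
exact: scale_regularE.
Qed.

(** The scalar $\lambda(S(\Lambda))$ is 1: compare [star_integrall_scale] with [star_integralr] at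
    $\Lambda\star\Lambda$ and apply [lam]. *)
Lemma star_integrall b : star lam Lam b = b.
Proof.
rewrite star_integrall_scale;
  suff -> : (lam (S Lam) : k) = 1 by rewrite scale1r.
have /(congr1 lam) := star_integrall_scale Lam.
by rewrite star_integralr lam_scale lam_Lam => ->; rewrite /= [RHS]mulr1.
Qed.

(* Expand x along the first leg of [Delta Lam] and S y along the second. *)
Lemma nakayama x y : lam (x * y) = lam (S (S y) * x).
Proof.
have xE : \Delta_(u, v <- Lam) ((lam (S v * x) : k) *: u) = x.
  by rewrite -starE2 // star_integrall.
have yE : \Delta_(u, v <- Lam) ((lam (u * y) : k) *: v) = S y.
  rewrite dual_integral_antipode //; apply: (sweedler_counitl (f := S)).
    by linear_tac.
  move=> u v; rewrite LamP.2 lam_scale lam_Lam; congr (_ *: _); exact: mulr1.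
(* With [x] expanded on the left and [S y] on the right, both sides become
   $\sum\lambda(S(v)x)\lambda(uy)$ over the legs $u,v$ of $\Delta(\Lambda)$. *)
rewrite -[in LHS]xE -[in RHS]yE.
rewrite (sweedler_map _ _ (h := fun t : A => lam (t * y))); last by linear_tac.
rewrite (sweedler_map _ _ (h := fun t : A => lam (S t * x)));
  last by linear_tac.
apply: eq_sweedler => u v.
rewrite -scalerAl lam_scale (linear_scale_fun _ _ (linear_lfun S))
  -scalerAl lam_scale.
exact: mulrC.
Qed.

(** By [starE2] and [starE] both sides are sums over $\Delta(a)$ with coefficients $\lambda(S(y)b)$
    and $\lambda(S^2(b)S(y))$, which agree by [nakayama]. *)
Lemma star_antipode a b : S (star lam a b) = star lam (S b) (S a).
Proof.
rewrite (starE2 lamP) starE sweedler_antipode; [|by linear_tac ..].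
rewrite (sweedler_map _ _ (linear_lfun S)); apply: eq_sweedler => x y.
by rewrite (linear_scale_fun _ _ (linear_lfun S)) nakayama.
Qed.

(* Insert [S (c_1) c_2] into [c (a * b)], move c_2 and c_3 past b in [Delta b],
   then carry c_2 around lam by nakayama. *)
Lemma central_star a b : central a -> central b -> central (star lam a b).
Proof.
move=> aC bC c.
pose F x y z : A :=
  \Delta_(u, v <- b) ((lam (S a * (S x * (y * u))) : k) *: (z * v)).
have bE x w : \Delta_(y, z <- w) F x y z =
  \Delta_(y, z <- w) \Delta_(u, v <- b) ((lam (S a * (S (x * S y) * u))
    : k) *: (v * z)).
  rewrite /F -(sweedlerM (f := fun p q => (lam (S a * (S x * p)) : k) *: q));
    [|by linear_tac ..].
  rewrite -bC sweedlerM; [|by linear_tac ..].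
  rewrite sweedler_swap; apply: eq_sweedler => y z; apply: eq_sweedler => u v.
  (* Brought to the front, $S^2(y)$ passes the central [S a] and joins [S x] as $S(xS(y))$, which
     contracts once the sum is bracketed to the left. *)
  congr ((_ : k) *: _); rewrite !mulrA nakayama antipodeM !mulrA.
  by rewrite (central_antipode aC).
transitivity (\Delta_(x, w <- c) \Delta_(y, z <- w) F x y z); last first.
  rewrite -sweedlerA; [|by rewrite /F => *; linear_tac ..].
  apply: (sweedler_counitl (f := fun z => z * star lam a b));
    first by linear_tac.
  move=> w z.
  pose f x := \Delta_(u, v <- b) ((lam (S a * (x * u)) : k) *: (z * v)).
  rewrite (sweedler_antipodel (f := f)); rewrite /f; last 2 first.
  - by linear_tac.
  - by move=> x y; rewrite /F; apply: eq_sweedler => u v; rewrite !mulrA.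
  congr (_ *: _); rewrite starE (sweedler_map _ _ (h := fun t : A => z * t));
    last by linear_tac.
  by apply: eq_sweedler => u v; rewrite mul1r -scalerAr.
transitivity (\Delta_(x, w <- c) \Delta_(y, z <- w) \Delta_(u, v <- b)
    ((lam (S a * (S (x * S y) * u)) : k) *: (v * z))); last first.
  by apply: eq_sweedler => x w; rewrite bE.
rewrite -sweedlerA; [|by linear_tac ..].
symmetry; apply: (sweedler_counitl (f := fun z => star lam a b * z)).
  by linear_tac.
move=> w z.
rewrite (sweedler_antipoder
  (f := fun x => \Delta_(u, v <- b) ((lam (S a * (S x * u))
    : k) *: (v * z)))) //; last by linear_tac.
congr (_ *: _); rewrite starE (sweedler_map _ _ (h := fun t : A => t * z));
  last by linear_tac.
by apply: eq_sweedler => u v; rewrite antipode1 mul1r -scalerAl.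
Qed.

(** * The R-matrix and the symmetry of [lam] on the centre *)

(** $g\otimes g=\Delta(g)$ is fixed by the flip, hence by conjugation with [R]. *)
Lemma grouplike_commutes_R : R * (g \ox g) = (g \ox g) * R.
Proof.
case: ribbonRg => [[Ru flipE _ _] [_ gE] _].
have := flipE g; rewrite gE tensor_liftE; [|by linear_tac ..].
by move=> /(congr1 (fun t => t * R)); rewrite divrK.
Qed.

(** By [nakayama] in each leg, [P] is a trace twisted by conjugation with $g\otimes g$ ([PM]). As
    [R] commutes with $g\otimes g$, conjugating by [R], that is, flipping $\Delta(b)$, leaves the
    value of [P] unchanged. *)
Lemma lam_sweedlerC w w' b : central w -> central w' -> central b ->
  \Delta_(x, y <- b) ((lam (w * x) : k) *: lam (w' * y)) =
  \Delta_(x, y <- b) ((lam (w * y) : k) *: lam (w' * x)).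
Proof.
move=> wC wC' bC.
pose P : 'Hom(A ⊗ A, k^o) :=
  tensor_lift (fun x y => (lam (w * x) : k) *: lam (w' * y)).
pose G : A ⊗ A := g \ox g; pose G' : A ⊗ A := g^-1 \ox g^-1.
have PE x y : P (x \ox y) = (lam (w * x) : k) *: lam (w' * y).
  by rewrite tensor_liftE //; linear_tac.
have PM (s t : A ⊗ A) : P (s * t) = P (G * t * G' * s).
  apply: (eq_linear_tensor
    (f := fun s => P (s * t)) (g := fun s => P (G * t * G' * s)));
      try by linear_tac.
  move=> x y.
  apply: (eq_linear_tensor
    (f := fun t => P (x \ox y * t))
      (g := fun t => P (G * t * G' * (x \ox y)))); try by linear_tac.
  move=> u v; rewrite !pure_tensorM !PE !mulrA
    nakayama [lam (w' * y * v)]nakayama.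
  by rewrite !antipode_sqr !mulrA -wC -wC' !mulrA.
case: ribbonRg => [[Ru flipE _ _] _ _].
have GG' : G * G' = 1 by rewrite pure_tensorM mulrV ?grouplike_unit.
apply: (etrans (y := P (tensor_flip A A (comul b)))); last first.
  rewrite /sweedler /tensor_flip (tensor_lift_map _ _ (linear_lfun P)).
  by apply: eq_tensor_lift => x y; rewrite PE.
rewrite flipE PM.
(* [PM] has carried $R^{-1}$ to the front, conjugated by [G]; it commutes with [G] and cancels
   against [R]. *)
have -> : G * R^-1 * G' * (R * comul b) = comul b :> A ⊗ A.
  have GR : G * R^-1 = R^-1 * G.
    have RG : R * G = G * R :> A ⊗ A := grouplike_commutes_R.
    by apply: (mulrI Ru); rewrite mulVKr // mulrA RG mulrK.
  by rewrite GR -[R^-1 * G * G']mulrA GG' mulr1 mulKr.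
by [].
Qed.

(** Take $b=\Lambda$ and $w'=1$ in [lam_sweedlerC]. One order of the legs gives
    $\lambda(S(w)\star\Lambda)=\lambda(S(w))$, the other $\lambda(w)\lambda(\Lambda)=\lambda(w)$ by
    the integral property. *)
Lemma lam_antipode_central w : central w -> lam (S w) = lam w.
Proof.
move=> wC.
have C1 : central 1 by move=> x; rewrite mul1r mulr1.
have := lam_sweedlerC wC C1 central_integral.
have -> : \Delta_(x, y <- Lam) ((lam (w * x) : k) *: lam (1 * y)) = lam (S w).
  rewrite -[S w in RHS]star_integralr
    starE (sweedler_map _ _ (linear_lfun lam)).
  by apply: eq_sweedler => x y; rewrite lam_scale mul1r antipode_sqr_central.
move=> ->; transitivity (lam (w * ((lam Lam : k)%:A)));
  last by rewrite lam_Lam scale1r mulr1.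
rewrite -dual_integralE // (sweedler_map _ _ (h := fun t : A => lam (w * t)));
  last by linear_tac.
apply: eq_sweedler => x y; rewrite -scalerAr lam_scale mul1r; exact: mulrC.
Qed.

Lemma lam_mul_star c a b :
  lam (c * star lam a b) =
    \Delta_(x, y <- b) ((lam (S a * x) : k) *: lam (c * y)).
Proof.
rewrite starE (sweedler_map _ _ (h := fun t : A => lam (c * t)));
  last by linear_tac.
by apply: eq_sweedler => x y; rewrite -scalerAr lam_scale.
Qed.

(** With $z=S(c)\star a$, [starE2] turns $\lambda(c(a\star b))$ into
    $\lambda(S(z)b)=\lambda(S(S(b)z))$. Here [S] may be dropped, $S(b)z$ being central, and what is
    left is $\lambda(c(b\star a))$ with the legs of $\Delta(a)$ exchanged. *)
Lemma lam_star_comm a b c : central a -> central b -> central c ->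
  lam (c * star lam a b) = lam (c * star lam b a).
Proof.
move=> aC bC cC.
have SbC := central_antipode bC; have ScC := central_antipode cC.
have zC := central_star ScC aC; set z := star lam (S c) a in zC.
have zE : z = \Delta_(x, y <- a) ((lam (c * x) : k) *: y).
  by rewrite /z starE antipode_sqr_central.
transitivity (lam (S z * b)).
  rewrite (starE2 lamP) zE (sweedler_map _ _
    (h := fun t : A => lam (S t * b))); last by linear_tac.
  rewrite (sweedler_map _ _ (h := fun t : A => lam (c * t)));
    last by linear_tac.
  apply: eq_sweedler => x y; rewrite -scalerAr lam_scale.
  by rewrite (linear_scale_fun _ _ (linear_lfun S)) -scalerAl lam_scale;
    exact: mulrC.
have -> : S z * b = S (S b * z) by rewrite antipodeM antipode_sqr_central.
rewrite lam_antipode_central; last exact: centralM.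
rewrite lam_mul_star // lam_sweedlerC //.
rewrite zE (sweedler_map _ _ (h := fun t : A => lam (S b * t)));
  last by linear_tac.
by apply: eq_sweedler => x y; rewrite -scalerAr lam_scale; exact: mulrC.
Qed.

(** Exchanging the legs of $\Delta(b)$ gives $\lambda(S(a)z)$ with $z=S(c)\star b$ central. This is
    $\lambda(S(S(z)a))=\lambda(aS(z))$, a pairing of [a] with a central element. *)
Lemma lam_star_radical a b c : central a -> central b -> central c ->
  (forall z, central z -> lam (a * z) = 0) -> lam (c * star lam a b) = 0.
Proof.
move=> aC bC cC a0.
have SaC := central_antipode aC; have ScC := central_antipode cC.
have zC := central_star ScC bC; set z := star lam (S c) b in zC.
rewrite lam_mul_star // lam_sweedlerC //.
transitivity (lam (S a * z)).
  rewrite /z starE antipode_sqr_central //.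
  rewrite (sweedler_map _ _ (h := fun t : A => lam (S a * t)));
    last by linear_tac.
  by apply: eq_sweedler => x y; rewrite -scalerAr lam_scale; exact: mulrC.
have -> : S a * z = S (S z * a) by rewrite antipodeM antipode_sqr_central.
rewrite lam_antipode_central.
  by rewrite (central_antipode zC) a0 //; apply: central_antipode.
exact/centralM/aC/central_antipode.
Qed.

End Integral.

(** * Descent to the centre and to its quotient *)

(** Bundles functions defined in the middle of a proof, where no instance can be declared. *)
Lemma bilinear_pack (k : fieldType) (U V W : lmodType k) (f : U -> V -> W) :
    (forall y, linear (f^~ y)) -> (forall x, linear (f x)) ->
  exists F : {bilinear U -> V -> W}, forall x y, F x y = f x y.
Proof.
move=> fl fr; pose m := bilinear_isBilinear.Build k U V W *:%R *:%R f (fl, fr).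
pose F : {bilinear U -> V -> W} := HB.pack f m.
by exists F.
Qed.

Lemma memv_center (k : fieldType) (A : falgType k) (a : A) :
  a \in 'Z({:A})%VS <-> forall x, a * x = x * a.
Proof.
rewrite memv_cap memvf /=; split => [/centvP aC x|aC].
  exact/aC/memvf.
by apply/centvP => x _; apply: aC.
Qed.

Lemma pi_center_linear (k : fieldType) (A : falgType k) (lam : 'Hom(A, k^o)) c
    (a b : center_alg A) :
  \pi_(center_quotient lam) (c *: a + b) =
  c *: \pi_(center_quotient lam) a + \pi_(center_quotient lam) b.
Proof. by rewrite raddfD /= pi_center_scale. Qed.

Unset Implicit Arguments.

Theorem lemma2p2 (k : fieldType) (A : hopfAlgType k) (R : A ⊗ A) (g : A)
    (Lam : A) (lam : 'Hom(A, k^o))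
    (hribbon : ribbon R g) (hunimodular : unimodular A)
    (hLam : integral Lam) (hlam : dual_right_integral lam)
    (hnorm : lam Lam = 1) :
  exists starZ : {bilinear center_alg A -> center_alg A -> center_alg A},
    [/\ forall a b : center_alg A,
          vsval (starZ a b) = star lam (vsval a) (vsval b),
        associative starZ,
        exists2 LamZ : center_alg A, vsval LamZ = Lam &
          left_id LamZ starZ /\ right_id LamZ starZ
      & forall a b : A, a \in 'Z({:A})%VS -> b \in 'Z({:A})%VS ->
          antipode (star lam a b) = star lam (antipode b) (antipode a)]
    /\
    exists starQ :
        {bilinear center_quotient lam -> center_quotient lam
                  -> center_quotient lam},
      [/\ forall a b : center_alg A,
            starQ (\pi_(center_quotient lam) a) (\pi_(center_quotient lam) b)
            = \pi_(center_quotient lam) (starZ a b),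
          associative starQ
        & commutative starQ].
Proof.
have valC (a : center_alg A) : forall x, vsval a * x = x * vsval a.
  exact/memv_center/subvsP.
have starC (a b : center_alg A) : star lam (vsval a) (vsval b) \in 'Z({:A})%VS.
  by apply/memv_center/(central_star hlam hLam hnorm hribbon); apply: valC.
(* The total projection [vsproj] avoids a dependent membership proof; by [starC] it does not alter
   the value. *)
pose starf (a b : center_alg A) : center_alg A :=
  vsproj 'Z({:A})%AS (star lam (vsval a) (vsval b)).
have starfE a b : vsval (starf a b) = star lam (vsval a) (vsval b).
  exact/vsprojK/starC.
have [starZ starZE] : exists F : {bilinear center_alg A -> center_alg A
  -> center_alg A},
    forall a b, F a b = starf a b.
  apply: bilinear_pack => [b c x y | a c x y]; apply: val_inj;
    rewrite /= !starfE.
    by rewrite !linearP /= linear_starl.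
  by rewrite !linearP /= linear_starr.
have starZval a b : vsval (starZ a b) = star lam (vsval a) (vsval b).
  by rewrite starZE.
exists starZ; split; [split=> // | ].
- by move=> a b c; apply: val_inj; rewrite /= !starZval starA.
- have LamC : Lam \in 'Z({:A})%VS by apply/memv_center/(central_integral hLam).
  exists (vsproj 'Z({:A})%AS Lam); first exact: vsprojK.
  split=> a; apply: val_inj; rewrite /= starZval vsprojK //.
    exact: star_integrall hnorm hribbon _.
  exact: star_integralr.
- by move=> a b _ _; exact: (star_antipode hlam hLam hnorm hribbon).
have radP (a : center_alg A) : a \in center_radical lam ->
    forall z, (forall x, z * x = x * z) -> lam (vsval a * z) = 0.
  move=> /center_radicalP a0 z zC.
  by rewrite -(vsprojK (iffRL (memv_center z) zC)) a0.
have starZC a b : starZ a b - starZ b a \in center_radical lam.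
  apply/center_radicalP => c; rewrite linearB /= !starZval mulrBl linearB /=.
  rewrite -!valC (lam_star_comm hlam hLam hnorm hribbon) ?subrr //; exact: valC.
have piC a b : \pi_(center_quotient lam) (starZ a b) =
  \pi_(center_quotient lam) (starZ b a).
  by apply/eqP; rewrite center_quotientE.
have radl a b : a \in center_radical lam -> starZ a b \in center_radical lam.
  move=> aK; apply/center_radicalP => c; rewrite starZval -valC.
  by apply: (lam_star_radical hlam hLam hnorm hribbon); try exact: valC;
    apply: radP.
have pil a a' b : \pi_(center_quotient lam) a = \pi_(center_quotient lam) a' ->
    \pi_(center_quotient lam) (starZ a b) =
      \pi_(center_quotient lam) (starZ a' b).
  move=> /eqP; rewrite center_quotientE => aK; apply/eqP;
    rewrite center_quotientE.
  by rewrite -linearBl /= radl.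
pose Q := center_quotient lam.
have [starQ starQE] : exists F : {bilinear Q -> Q -> Q},
    forall q r, F q r = \pi_Q (starZ (repr q) (repr r)).
  (* Independence of representatives: [pil] treats the left argument, and the right one is reached
     by swapping with [piC] before and after. *)
  have starf_pi a b : \pi_Q (starZ (repr (\pi_Q a)) (repr (\pi_Q b))) =
    \pi_Q (starZ a b).
    by rewrite (pil _ a) ?reprK // piC (pil _ b) ?reprK // piC.
  apply: bilinear_pack => [r c p q | r c p q].
    rewrite -[p]reprK -[q]reprK -[r]reprK -pi_center_linear !starf_pi.
    by rewrite linearPl pi_center_linear.
  rewrite -[p]reprK -[q]reprK -[r]reprK -pi_center_linear !starf_pi.
  by rewrite linearPr pi_center_linear.
have starQpi a b : starQ (\pi_Q a) (\pi_Q b) = \pi_Q (starZ a b).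
  by rewrite starQE (pil _ a) ?reprK // piC (pil _ b) ?reprK // piC.
exists starQ; split => //.
  move=> p q r; rewrite -[p]reprK -[q]reprK -[r]reprK !starQpi; congr (\pi_Q _).
  by apply: val_inj; rewrite /= !starZval starA.
by move=> p q; rewrite -[p]reprK -[q]reprK !starQpi piC.
Qed.
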